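(* If $p$ is prime and $G=\operatorname{Circ}(p,S)$, then $\operatorname{mcr}_+(G)=p-|S|$.
   Context: Matrices are indexed from $0$. For a positive integer $n$ and a set $S\subseteq\{1,\dots,n-1\}$ closed under taking additive inverses modulo $n$, $\operatorname{Circ}(n,S)$ is the simple graph on $\{0,1,\dots,n-1\}$ in which distinct $i,j$ are adjacent iff $(i-j)\bmod n\in S$ (so the neighborhood of vertex $0$ is $S$). An $n\times n$ Hermitian matrix $A$ has graph $G$ (where $V(G)=\{0,\dots,n-1\}$) if for all $i\ne j$: $A_{ij}\neq 0$ iff $\{i,j\}\in E(G)$; diagonal entries are unrestricted. $A$ is a circulant matrix if $A_{ij}$ depends only on $i-j$ modulo $n$. For a circulant graph $G$, $\operatorname{mcr}_+(G)$ is the minimum rank of a positive semidefinite Hermitian circulant matrix with graph $G$.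
   Formalization: The formal theorem assumes that S is nonempty; for S empty the zero matrix is a positive semidefinite circulant matrix with graph Circ(p,S), so the minimum rank is 0 and not p, and the claim fails there. *)

(* Defs.v *)
From mathcomp Require Import all_boot all_order all_algebra.
From mathcomp Require Import sesquilinear spectral.
From mathcomp Require Import reals complex.

Set Implicit Arguments.
Unset Strict Implicit.
Unset Printing Implicit Defensive.

Import Order.TTheory GRing.Theory Num.Theory Num.Def.
Local Open Scope ring_scope.
Local Open Scope sesquilinear_scope.

Lemma ord_gt0 n (i : 'I_n) : (0 < n)%N.
Proof. exact: leq_ltn_trans (leq0n i) (ltn_ord i). Qed.

(* Arithmetic modulo n on 'I_n for an arbitrary n; MathComp only provides the
   additive structure on ordinals when n is syntactically a successor. *)
Definition oppm n (i : 'I_n) : 'I_n :=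
  Ordinal (ltn_pmod (n - i) (ord_gt0 i)).

Definition subm n (i j : 'I_n) : 'I_n :=
  Ordinal (ltn_pmod (i + (n - j)) (ord_gt0 i)).

Definition Circ n (S : {set 'I_n}) : rel 'I_n :=
  [rel i j | (i != j) && (subm i j \in S)].

Lemma Circ_irr n (S : {set 'I_n}) : irreflexive (Circ S).
Proof. by move=> i; rewrite /Circ /= eqxx. Qed.

Lemma subm_opp n (i j : 'I_n) : subm j i = oppm (subm i j).
Proof.
apply: val_inj => /=; have [li lj] := (ltn_ord i, ltn_ord j).
have n0 := ord_gt0 i; have lm := ltn_pmod (i + (n - j))%N n0.
apply/eqP; rewrite -(eqn_modDr ((i + (n - j)) %% n)%N) (subnK (ltnW lm)) modnn.
rewrite modnDmr; suff -> : (j + (n - i) + (i + (n - j)) = n + n)%N.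
  by rewrite modnDl modnn.
by rewrite -addnA (addnA (n - i)%N) subnK ?(ltnW li) // addnCA subnKC ?(ltnW lj).
Qed.

Lemma Circ_sym n (S : {set 'I_n}) :
  (forall s : 'I_n, s \in S -> oppm s \in S) -> symmetric (Circ S).
Proof.
move=> Sopp i j; rewrite /Circ /= eq_sym; congr (_ && _).
by apply/idP/idP => /Sopp; rewrite -subm_opp.
Qed.

Section Matrices.
Variables (C : numClosedFieldType) (n : nat).
Implicit Types (A : 'M[C]_n) (e : rel 'I_n).

Definition has_graph A e : Prop :=
  forall i j : 'I_n, i != j -> (A i j != 0) = e i j.

Definition circulantmx A : Prop :=
  forall i j k l : 'I_n, subm i j = subm k l -> A i j = A k l.

(* The order of C is partial: [0 <= z] says that z is real and nonnegative. *)
Definition psdmx A : Prop :=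
  A \is hermsymmx /\ forall x : 'cV[C]_n, 0 <= (x ^t* *m A *m x) 0 0.

Definition is_mcr_plus e (r : nat) : Prop :=
  (exists A, [/\ psdmx A, circulantmx A, has_graph A e & \rank A = r]) /\
  (forall A, psdmx A -> circulantmx A -> has_graph A e -> (r <= \rank A)%N).

End Matrices.

Arguments is_mcr_plus C [n] e r.

(* Main.v *)
Require Import Defs.
From mathcomp Require Import all_boot all_order all_algebra.
From mathcomp Require Import sesquilinear spectral.
From mathcomp Require Import reals complex.
From mathcomp Require Import zify ring.

Set Implicit Arguments.
Unset Strict Implicit.
Unset Printing Implicit Defensive.

Import Order.TTheory GRing.Theory Num.Theory.
Local Open Scope ring_scope.

(** A circulant matrix with first column [a] is diagonalised by the Fourier
matrix, and its eigenvalues are the values of the discrete Fourier transform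
of [a]. The problem is therefore about pairs (first column, spectrum) linked
by a Fourier transform of prime length p, and both bounds rest on the
uncertainty principle [dft_uncertainty]: for f nonzero, the supports of f and
of its transform have more than p elements in total.

Lower bound ([circulant_rank_ge]). The first column of a matrix with graph
Circ(p, S) is supported in S together with 0, hence has at most #|S| + 1
nonzero entries, so the spectrum has at least p - #|S| nonzero entries.

Upper bound ([psd_circulant_exists]). The nonnegative spectra whose transform
is supported in S together with 0 form, once normalised to a fixed sum, a
polytope of dimension #|S|; it is nonempty because the constant spectrum (a
scalar matrix) lies in it. At a vertex at least #|S| of the sign constraints
are tight, so the rank is at most p - #|S|. The uncertainty principle then
forces equality everywhere: the rank is p - #|S|, and the first column is
nonzero on all of S, so that the graph is the whole of Circ(p, S). The vertex
is reached by moving from any point of the polytope in a feasible direction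
until a new coordinate vanishes ([spectrum_shrink]).

The uncertainty principle amounts to Chebotarev's theorem that the minors of
the Fourier matrix of prime order p do not vanish. Expanding each monomial y^j
in the Newton basis at the nodes w^(i 0), w^(i 1), ... factors the matrix of
such a minor into a triangular matrix with nonzero diagonal and the matrix of
Newton coefficients, which are the values at X = w of integer polynomials in
X. An integer polynomial that vanishes at w also vanishes modulo p at X = 1
([root_int_prim_Fp]). At X = 1 all nodes coincide with 1 and the Newton
coefficient of y^j at rank k is the binomial coefficient of j and k; the
determinant of these is nonzero modulo p by polynomial interpolation
([det_binomial_neq0]). *)

(** * Newton coefficients of monomials *)

(** Divided difference of y^j at the nodes [x 0], ..., [x k]: the coefficient
of y^j on the k-th Newton polynomial, the product of the y - [x l] for l < k.
The recursion comes from y * N_k = N_(k+1) + [x k] * N_k. It involves no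
division, so it makes sense for repeated nodes and commutes with ring
morphisms, which allows the specialisation of the nodes to 1. *)
Fixpoint newton_coef (A : comNzRingType) (x : nat -> A) (j k : nat) : A :=
  if j is j'.+1 then
    x k * newton_coef x j' k + (if k is k'.+1 then newton_coef x j' k' else 0)
  else (k == 0)%:R.

Lemma newton_coef_gt (A : comNzRingType) (x : nat -> A) j k :
  (j < k)%N -> newton_coef x j k = 0.
Proof.
elim: j k => [|j IHj] [|k] //= ltjk.
by rewrite !IHj ?mulr0 ?addr0 // ltnW.
Qed.

Lemma exp_newton (A : comNzRingType) (x : nat -> A) (y : A) n j : (j < n)%N ->
  y ^+ j = \sum_(k < n) newton_coef x j k * \prod_(l < k) (y - x l).
Proof.
elim: n j => [//|n IHn] [_|j].
  rewrite big_ord_recl big_ord0 mulr1 big1 ?addr0 // => i _.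
  by rewrite /= mul0r.
rewrite ltnS => ltjn.
rewrite exprS (IHn _ ltjn) mulr_sumr.
under [RHS]eq_bigr do rewrite /= mulrDl.
rewrite big_split /= big_ord_recr /= (newton_coef_gt x ltjn) mulr0 mul0r addr0.
rewrite big_ord_recl mul0r add0r -big_split /=; apply: eq_bigr => k _.
by rewrite big_ord_recr /=; ring.
Qed.

Lemma eq_newton_coef (A : comNzRingType) (x y : nat -> A) j k :
  x =1 y -> newton_coef x j k = newton_coef y j k.
Proof. by move=> eqxy; elim: j k => [|j IHj] [|k] //=; rewrite !IHj eqxy. Qed.

Lemma newton_coef_morph (A B : comNzRingType) (f : {rmorphism A -> B}) x j k :
  f (newton_coef x j k) = newton_coef (f \o x) j k.
Proof.
elim: j k => [|j IHj] [|k] /=; rewrite ?rmorph_nat //.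
  by rewrite rmorphD rmorphM rmorph0 IHj.
by rewrite rmorphD rmorphM !IHj.
Qed.

(** When all nodes are 1 the Newton basis consists of the powers of y - 1, and
the recursion becomes Pascal's rule. *)
Lemma newton_coef1 (A : comNzRingType) (x : nat -> A) j k :
  (forall l, x l = 1) -> newton_coef x j k = 'C(j, k)%:R.
Proof.
move=> x1; elim: j k => [|j IHj] [|k] //=; rewrite x1 mul1r !IHj.
  by rewrite !bin0 addr0.
by rewrite binS natrD.
Qed.

(** At the node [x a] all Newton polynomials of rank greater than [a] vanish,
and the one of rank [a] does not: the system is triangular. *)
Lemma newton_free (F : idomainType) (x g : nat -> F) t n :
  (t <= n)%N ->
  {in gtn t &, injective x} ->
  (forall a, (a < t)%N ->
     \sum_(k < n) g k * \prod_(l < k) (x a - x l) = 0) ->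
  forall a, (a < t)%N -> g a = 0.
Proof.
move=> letn xinj gx0 a; elim/ltn_ind: a => a IHa ltat.
have := gx0 a ltat; have ltan := leq_trans ltat letn.
rewrite (bigD1 (Ordinal ltan)) //= [X in _ + X]big1 ?addr0 => [/eqP | k neka].
  rewrite mulf_eq0 => /orP[/eqP //|/prodf_eq0[l _]].
  rewrite subr_eq0 => /eqP/xinj/= xal.
  by have := ltn_ord l; rewrite -xal ?ltnn // inE // (ltn_trans (ltn_ord l)).
case: (ltngtP k a) => [ltka|ltak|eqka].
- by rewrite IHa ?mul0r // (ltn_trans ltka).
- by rewrite (bigD1 (Ordinal ltak)) //= subrr mul0r mulr0.
- by rewrite -val_eqE /= eqka eqxx in neka.
Qed.

(** The Newton polynomials at the nodes 0, 1, 2, ... are the falling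
factorials. *)
Lemma natr_ffact (A : comNzRingType) j k :
  \prod_(l < k) (j%:R - l%:R) = (j ^_ k)%:R :> A.
Proof.
elim: k => [|k IHk]; first by rewrite big_ord0.
rewrite big_ord_recr /= IHk ffactnSr natrM.
case: (leqP k j) => [lekj|ltjk]; first by rewrite natrB.
by rewrite ffact_small // !mul0r.
Qed.

(** * Nonsingularity modulo p *)

Lemma natrF_inj p : prime p ->
  {in gtn p &, injective (fun i : nat => i%:R : 'F_p)}.
Proof.
move=> pr_p i j; rewrite !inE => ltip ltjp /(congr1 val) /=.
by rewrite !val_Fp_nat // !modn_small.
Qed.

(** A linear relation between the columns is a polynomial of degree less than
t, written on the basis of the binomial polynomials, that vanishes at the t
distinct points [J b] of 'F_p. It is zero, and so are its coefficients,
because k! is invertible modulo p for k < t <= p. *)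
Lemma det_binomial_neq0 p t (J : 'I_t -> 'I_p) : prime p -> injective J ->
  \det (\matrix_(b < t, k < t) ('C(J b, k)%:R : 'F_p)) != 0.
Proof.
move=> pr_p Jinj; have letp : (t <= p)%N.
  by rewrite -[t]card_ord -[p]card_ord; apply: leq_card Jinj.
rewrite -det_tr; apply/det0P => -[c c_neq0 cB0].
have factN0 k : (k < t)%N -> k`!%:R != 0 :> 'F_p.
  elim: k => [|k IHk] ltkt; first by rewrite oner_eq0.
  rewrite factS natrM mulf_neq0 ?IHk ?(ltnW ltkt) //; apply/eqP.
  move/(natrF_inj pr_p (y := 0)); rewrite !inE prime_gt0 //.
  by rewrite (leq_trans ltkt) // => /(_ isT isT).
(* Coefficients of the relation on the falling factorials; [c] is extended by
   0 to all natural numbers. *)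
pose g k : 'F_p := oapp (c 0) 0 (insub k) / k`!%:R.
pose q : {poly 'F_p} := \sum_(k < t) g k *: \prod_(l < k) ('X - (l%:R)%:P).
have qE y : q.[y] = \sum_(k < t) g k * \prod_(l < k) (y - l%:R).
  rewrite horner_sum; apply: eq_bigr => k _; rewrite hornerZ horner_prod.
  by congr (_ * _); apply: eq_bigr => l _; rewrite hornerXsubC.
have gE (k : 'I_t) : g k = c 0 k / k`!%:R by rewrite /g valK.
have q0 : q = 0.
  apply: (@roots_geq_poly_eq0 _ _ [seq (J b)%:R | b : 'I_t]).
  - apply/allP => _ /imageP[b _ ->]; rewrite rootE qE.
    have /matrixP/(_ 0 b) := cB0; rewrite !mxE => cb0.
    apply/eqP; rewrite -[RHS]cb0; apply: eq_bigr => k _.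
    rewrite !mxE gE natr_ffact -bin_ffact natrM; field.
    exact: factN0.
  - rewrite map_inj_uniq ?enum_uniq // => a b /(natrF_inj pr_p) eqab.
    by apply: Jinj; apply: val_inj; apply: eqab; rewrite inE.
  rewrite size_image card_ord; apply: (leq_trans (size_sum _ _ _)).
  apply/bigmax_leqP => k _; apply: leq_trans (size_scale_leq _ _) _.
  by rewrite size_prod_XsubC /index_enum -enumT size_enum_ord.
case/eqP: c_neq0; apply/rowP => k; rewrite mxE.
have: g k = 0.
  apply: (newton_free (x := fun i => i%:R) (leqnn t)) => //.
    move=> i j lti ltj; apply: (natrF_inj pr_p).
      exact: leq_trans lti letp.
    exact: leq_trans ltj letp.
  by move=> a _; rewrite -qE q0 horner0.
by rewrite gE => /eqP; rewrite mulf_eq0 invr_eq0 (negbTE (factN0 _ _)) //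
                     orbF => /eqP.
Qed.

(** Reduction of w to 1 modulo p. The gcd of [D] and X^p - 1 over the
rationals is not constant, since both vanish at w. By Gauss's lemma its
primitive part z divides both over the integers, and its leading coefficient
is a unit because X^p - 1 is monic; so z modulo p is a nonconstant divisor of
X^p - 1 = (X - 1)^p, and vanishes at 1. *)
Lemma root_int_prim_Fp p (C : numFieldType) (w : C) (D : {poly int}) :
  prime p -> p.-primitive_root w -> root (map_poly intr D) w ->
  D.[1]%:~R = 0 :> 'F_p.
Proof.
move=> pr_p w_prim Dw; pose q : {poly int} := 'X^p - 1.
pose toQ := map_poly (intr : int -> rat).
pose g := gcdp (toQ D) (toQ q).
have g_gt1 : (1 < size g)%N.
  have gw : root (map_poly ratr g) w.
    rewrite gcdp_map root_gcd -!map_poly_comp /=.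
    have eqf : ratr \o intr =1 (intr : int -> C) by move=> z /=; rewrite ratr_int.
    rewrite !(eq_map_poly eqf) Dw /= rmorphB rmorph1 /= map_polyXn rootE.
    by rewrite !hornerE (prim_expr_order w_prim) subrr.
  rewrite -(size_map_poly (ratr : rat -> C)).
  apply: (root_size_gt1 _ gw).
  rewrite map_poly_eq0 gcdp_eq0 negb_and; apply/orP; right.
  by rewrite map_poly_eq0_id0 ?intr_eq0 ?lead_coef_eq0 // -size_poly_eq0
             size_XnsubC ?prime_gt0.
have [h [a a_neq0 gE]] := rat_poly_scale g.
have hg : g %= toQ h by rewrite gE eqp_scale // invr_eq0 intr_eq0.
have hD : h %| D by rewrite -dvdp_rat_int -(eqp_dvdl _ hg) dvdp_gcdl.
have hq : h %| q by rewrite -dvdp_rat_int -(eqp_dvdl _ hg) dvdp_gcdr.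
have [r DE] := dvdpP_int hD; have [s qE] := dvdpP_int hq.
set z := zprimitive h in DE qE.
have z_gt1 : (1 < size z)%N.
  rewrite size_zprimitive; have <- : size (toQ h) = size h.
    by apply: size_map_inj_poly => //; apply: intr_inj.
  by rewrite -(eqp_size hg).
pose toF := map_poly (intr : int -> 'F_p).
have zF_gt1 : (1 < size (toF z))%N.
  have lead1 : lead_coef z * lead_coef s = 1.
    by rewrite -lead_coefM -qE lead_coefXnsubC // prime_gt0.
  rewrite size_map_poly_id0 //; apply/eqP => z0.
  have := congr1 (intr : int -> 'F_p) lead1; rewrite rmorphM /= z0 mul0r.
  by move/eqP; rewrite eq_sym oner_eq0.
have chF : p \in [pchar {poly 'F_p}] by rewrite pchar_poly pchar_Fp.
have : toF z %| ('X - 1%:P) ^+ p.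
  rewrite exprDn_pchar ?pnatE // exprNn_pchar ?pnatE // -rmorphXn expr1n.
  have -> : 'X^p - 1 = toF q by rewrite /toF rmorphB rmorph1 /= map_polyXn.
  by rewrite qE /toF rmorphM dvdp_mulr.
case/dvdp_exp_XsubCP => [[|k] _ zk].
  by rewrite (eqp_size zk) size_poly1 in zF_gt1.
have : root (toF z) 1 by rewrite (eqp_root zk) root_exp_XsubC.
rewrite DE hornerM rmorphM /= => /eqP.
by rewrite -[1 in LHS](rmorph1 (intr : {rmorphism int -> 'F_p})) horner_map /= => ->;
   rewrite mul0r.
Qed.

(** The matrix of Newton coefficients at the nodes w^(i a) is the value at w
of a matrix of integer polynomials, which at X = 1 is the matrix of binomial
coefficients. *)
Lemma newton_coef_prim_free p (C : numFieldType) (w : C) t (J : 'I_t -> 'I_p)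
    (i : nat -> nat) (v : 'I_t -> C) :
  prime p -> p.-primitive_root w -> injective J ->
  (forall k : 'I_t,
     \sum_b v b * newton_coef (fun a => w ^+ i a) (J b) k = 0) ->
  forall b, v b = 0.
Proof.
move=> pr_p w_prim Jinj vH0.
pose H := \matrix_(b < t, k < t)
  newton_coef (fun a => 'X^(i a) : {poly int}) (J b) k.
pose toC : {rmorphism {poly int} -> C} :=
  horner_eval w \o map_poly (intr : int -> C).
have toCH : map_mx toC H =
    \matrix_(b < t, k < t) newton_coef (fun a => w ^+ i a) (J b) k.
  apply/matrixP => b k; rewrite !mxE (newton_coef_morph toC).
  by apply: eq_newton_coef => l /=; rewrite map_polyXn horner_evalE hornerXn.
pose toF : {rmorphism {poly int} -> 'F_p} := intr \o horner_eval (1 : int).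
have toFH : map_mx toF H = \matrix_(b < t, k < t) 'C(J b, k)%:R.
  apply/matrixP => b k; rewrite !mxE (newton_coef_morph toF) newton_coef1 //.
  by move=> l /=; rewrite /= horner_evalE hornerXn expr1n.
have detH_neq0 : \det (map_mx toC H) != 0.
  apply/eqP; rewrite det_map_mx => /eqP/(root_int_prim_Fp pr_p w_prim) detH0.
  by have /eqP[] := det_binomial_neq0 pr_p Jinj; rewrite -toFH det_map_mx.
pose u := \row_b v b.
have [u0 b|/negP[]] := eqVneq u 0.
  by have /rowP/(_ b) := u0; rewrite !mxE.
apply: contraNT detH_neq0 => u_neq0; apply/det0P; exists u => //.
apply/rowP => k; rewrite toCH !mxE -[RHS](vH0 k).
by apply: eq_bigr => b _; rewrite !mxE.
Qed.

(** * The uncertainty principle *)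

Definition supp n (C : nmodType) (f : 'I_n -> C) : {set 'I_n} :=
  [set k | f k != 0].

Definition dft n (C : nzRingType) (w : C) (f : 'I_n -> C) (k : 'I_n) : C :=
  \sum_j f j * w ^+ (j * k).

(** If the conclusion fails, the transform of [f] has at least as many zeros
w^k as [f] has nonzero entries. At these zeros, taken as nodes, the transform
is written on the Newton basis; triangularity makes its coefficients vanish,
and the nonsingularity of the matrix of Newton coefficients makes [f] vanish.
*)
Lemma dft_uncertainty p (C : numFieldType) (w : C) (f : 'I_p -> C) :
  prime p -> p.-primitive_root w -> supp f != set0 ->
  (p < #|supp f| + #|supp (dft w f)|)%N.
Proof.
move=> pr_p w_prim /set0Pn[j0 fj0]; rewrite ltnNge; apply/negP => le_p.
set J := supp f in fj0 le_p; pose Z := ~: supp (dft w f).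
pose s := [seq nat_of_ord k | k <- enum Z]; pose i a := nth 0%N s a.
have size_s : size s = #|Z| by rewrite size_map -cardE.
have leJZ : (#|J| <= #|Z|)%N.
  have /eqP := cardsC (supp (dft w f)); rewrite card_ord -/Z.
  move=> /eqP Ep.
  by rewrite -(leq_add2r #|supp (dft w f)|) [X in (_ <= X)%N]addnC Ep.
have iP a : (a < #|Z|)%N -> exists2 k, k \in Z & i a = k :> nat.
  move=> lta; have /mapP[k] : i a \in s by rewrite mem_nth ?size_s.
  by rewrite mem_enum => kZ ->; exists k.
have [k0 k0J] : exists k0 : 'I_#|J|, enum_val k0 = j0.
  by exists (enum_rank_in fj0 j0); rewrite enum_rankK_in.
suff fJ0 : forall b : 'I_#|J|, f (enum_val b) = 0.
  by move: fj0; rewrite inE -k0J fJ0 eqxx.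
apply: (@newton_coef_prim_free p C w #|J| enum_val i (fun b => f (enum_val b))
  pr_p w_prim (@enum_val_inj _ _)) => k.
set x := fun a : nat => w ^+ i a.
pose g k := \sum_(b < #|J|) f (enum_val b) * newton_coef x (enum_val b) k.
apply: (@newton_free _ x g #|J| p) (ltn_ord k).
- by rewrite (leq_trans (max_card _)) ?card_ord.
- move=> a b; rewrite !inE => lta ltb /eqP.
  have [ka kaZ ia] := iP a (leq_trans lta leJZ).
  have [kb kbZ ib] := iP b (leq_trans ltb leJZ).
  rewrite /x (eq_prim_root_expr w_prim) ia ib !modn_small // -ia -ib.
  rewrite nth_uniq ?size_s ?(leq_trans _ leJZ) //; first by move/eqP.
  by rewrite map_inj_uniq ?enum_uniq //; apply: val_inj.
move=> a lta; have [ka kaZ ia] := iP a (leq_trans lta leJZ).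
have : dft w f ka = 0 by move: kaZ; rewrite !inE negbK => /eqP.
(* Only the terms in the support of [f] contribute; expanding each monomial in
   the Newton basis turns the value of the transform into a combination of
   Newton polynomials with coefficients [g]. *)
rewrite /dft (bigID (mem J)) /= [X in _ + X]big1 ?addr0; last first.
  by move=> j; rewrite inE negbK => /eqP->; rewrite mul0r.
rewrite (big_enum_val (fun j : 'I_p => f j * w ^+ (j * ka))) => dft0.
rewrite -[RHS]dft0.
under [RHS]eq_bigr => b _.
  rewrite mulnC exprM -ia -/(x a) (exp_newton x (x a) (ltn_ord _)) mulr_sumr.
  over.
rewrite [RHS]exchange_big /=; apply: eq_bigr => l _; rewrite /g mulr_suml.
by apply: eq_bigr => b _; rewrite mulrA.
Qed.

(** A root of 1 + X + ... + X^(p-1) is a p-th root of unity different from 1,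
as the value of this polynomial at 1 is p. *)
Lemma prim_root_prime_exists (C : numClosedFieldType) p : prime p ->
  exists w : C, p.-primitive_root w.
Proof.
move=> pr_p; pose q : {poly C} := \poly_(i < p) 1.
have q_size : size q = p.
  by rewrite size_poly_eq ?oner_eq0.
have [w qw] : exists w, root q w.
  by apply/closed_rootP; rewrite q_size neq_ltn prime_gt1 ?orbT.
have w1 : w ^+ p = 1.
  apply/eqP; rewrite -subr_eq0 subrX1.
  move: qw; rewrite rootE horner_poly; under eq_bigr do rewrite mul1r.
  by move/eqP->; rewrite mulr0.
have [m w_prim] := prim_order_exists (prime_gt0 pr_p) w1.
case/primeP: (pr_p) => _ /(_ m) /[apply] /orP[] /eqP mE;
  last by exists w; rewrite -mE.
have := prim_expr_order w_prim; rewrite mE expr1 => w_eq1.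
move: qw; rewrite rootE horner_poly w_eq1.
under eq_bigr do rewrite expr1n mulr1.
by rewrite sumr_const card_ord pnatr_eq0 eqn0Ngt prime_gt0.
Qed.

(** * Diagonalisation of circulant matrices *)

Lemma prim_root_neq0 n (R : nzRingType) (w : R) : n.-primitive_root w -> w != 0.
Proof.
move=> w_prim; apply/eqP => w0; have /eqP := prim_expr_order w_prim.
by rewrite w0 expr0n gtn_eqF ?(prim_order_gt0 w_prim) // eq_sym oner_eq0.
Qed.

(** The map i |-> w^i turns subtraction modulo n into division, so that
the cancellation laws of [subm] follow from those of the field. *)
Lemma prim_expr_subm n (F : fieldType) (w : F) (i j : 'I_n) :
  n.-primitive_root w -> w ^+ subm i j = w ^+ i / w ^+ j.
Proof.
move=> w_prim; rewrite /= (prim_expr_mod w_prim) exprD; congr (_ * _).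
have w_neq0 : w != 0 := prim_root_neq0 w_prim.
apply: (mulIf (expf_neq0 j w_neq0)).
by rewrite mulVf ?expf_neq0 // -exprD subnK ?(prim_expr_order w_prim) // ltnW.
Qed.

Lemma prim_ord_inj n (R : nzRingType) (w : R) :
  n.-primitive_root w -> injective (fun i : 'I_n => w ^+ i).
Proof.
move=> w_prim i j /eqP; rewrite (eq_prim_root_expr w_prim) !modn_small //.
by move/eqP/val_inj.
Qed.

Lemma prim_subm_inj n (R : fieldType) (w : R) (i : 'I_n) :
  n.-primitive_root w -> injective (subm i).
Proof.
move=> w_prim j k /(congr1 (fun m : 'I_n => w ^+ m)).
have wi_neq0 : w ^+ i != 0 by rewrite expf_neq0 ?(prim_root_neq0 w_prim).
rewrite !(prim_expr_subm _ _ w_prim) => /(mulfI wi_neq0)/invr_inj.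
exact: prim_ord_inj.
Qed.

Lemma sum_prim_exp n (R : idomainType) (w : R) (d : 'I_n) :
  n.-primitive_root w ->
  \sum_(k < n) w ^+ (d * k) = (d == 0 :> nat)%:R * n%:R.
Proof.
move=> w_prim; have [d0|d_neq0] := eqVneq (d : nat) 0%N.
  by under eq_bigr do rewrite d0; rewrite sumr_const card_ord mul1r.
rewrite mul0r; have : (w ^+ d - 1) * \sum_(k < n) (w ^+ d) ^+ k = 0.
  by rewrite -subrX1 exprAC (prim_expr_order w_prim) expr1n subrr.
move/eqP; rewrite mulf_eq0 subr_eq0.
rewrite -(prim_order_dvd w_prim) gtnNdvd ?lt0n //= => /eqP sum0.
by rewrite -[RHS]sum0; apply: eq_bigr => k _; rewrite exprM.
Qed.

Lemma subm_eq0 n (R : fieldType) (w : R) (i j : 'I_n) :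
  n.-primitive_root w -> (subm i j == 0%N :> nat) = (i == j).
Proof.
move=> w_prim; rewrite -(modn_small (ltn_ord (subm i j))) -(mod0n n).
rewrite -(eq_prim_root_expr w_prim) (prim_expr_subm _ _ w_prim) expr0.
have wj : w ^+ j != 0 by rewrite expf_neq0 ?(prim_root_neq0 w_prim).
rewrite -(inj_eq (prim_ord_inj w_prim)) -(inj_eq (mulIf wj)).
by rewrite divfK // mul1r.
Qed.

Definition fourier_mx n (R : nzRingType) (w : R) : 'M_n :=
  \matrix_(i, k) w ^+ (i * k).

Lemma fourier_mxV n (R : fieldType) (w : R) :
  n.-primitive_root w ->
  fourier_mx n w *m fourier_mx n w^-1 = n%:R%:M.
Proof.
move=> w_prim; apply/matrixP => i j; rewrite !mxE.
have -> : \sum_k fourier_mx n w i k * fourier_mx n w^-1 k j =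
    \sum_(k < n) w ^+ (subm i j * k).
  apply: eq_bigr => k _; rewrite !mxE exprM exprVn [(k * j)%N]mulnC !exprM.
  by rewrite -exprVn -exprMn (prim_expr_subm _ _ w_prim).
rewrite (sum_prim_exp _ w_prim) mulr_natl.
by rewrite (subm_eq0 _ _ w_prim).
Qed.

Lemma fourier_mx_unit n (R : numFieldType) (w : R) :
  n.-primitive_root w -> fourier_mx n w \in unitmx.
Proof.
move=> w_prim; have n_neq0 : n%:R != 0 :> R.
  by rewrite pnatr_eq0 -lt0n (prim_order_gt0 w_prim).
have: fourier_mx n w *m (n%:R^-1 *: fourier_mx n w^-1) = 1%:M.
  by rewrite -scalemxAr fourier_mxV // scale_scalar_mx mulVf.
by case/mulmx1_unit.
Qed.

Lemma rank_diag_mx_le n (F : fieldType) (d : 'rV[F]_n) :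
  (\rank (diag_mx d) <= #|supp (d 0%R)|)%N.
Proof.
have -> : diag_mx d = \sum_(k in supp (d 0)) d 0 k *: delta_mx k k.
  rewrite diag_mx_sum_delta (bigID (mem (supp (d 0)))) /=
          [X in _ + X]big1 ?addr0 //.
  by move=> k; rewrite inE negbK => /eqP->; rewrite scale0r.
rewrite -sum1_card.
apply: (big_ind2 (fun (D : 'M_n) r => \rank D <= r)%N)
  => [|D r E s leDr leEs|k _].
- by rewrite mxrank0.
- exact: leq_trans (mxrank_add _ _) (leq_add leDr leEs).
by rewrite (leq_trans (mxrankS (scalemx_sub _ (submx_refl _)))) ?mxrank_delta.
Qed.

(** Filling the zero entries of the diagonal with ones gives an invertible
matrix, and the filling matrix has rank at most the number of these zeros:
subadditivity of the rank gives the lower bound. *)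
Lemma rank_diag_mx n (F : fieldType) (d : 'rV[F]_n) :
  \rank (diag_mx d) = #|supp (d 0)|.
Proof.
apply/eqP; rewrite eqn_leq rank_diag_mx_le /=.
pose e : 'rV[F]_n := \row_k (d 0 k == 0)%:R.
have e_rank : (\rank (diag_mx e) <= #|~: supp (d 0%R)|)%N.
  apply: leq_trans (rank_diag_mx_le _) _; apply: subset_leq_card.
  by apply/subsetP => k; rewrite !inE mxE negbK; case: (d 0 k == 0);
     rewrite ?eqxx.
have de_unit : diag_mx d + diag_mx e \in unitmx.
  rewrite -raddfD /= unitmxE det_diag unitfE; apply/prodf_neq0 => k _.
  by rewrite !mxE; have [->|] := eqVneq (d 0 k) 0;
     rewrite ?add0r ?oner_eq0 ?addr0.
have := mxrank_add (diag_mx d) (diag_mx e); rewrite mxrank_unit // => n_le.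
rewrite -(leq_add2r #|~: supp (d 0)|) cardsC card_ord (leq_trans n_le) //.
by rewrite leq_add2l.
Qed.

(** The columns of the Fourier matrix are eigenvectors of every circulant
matrix. *)
Lemma circulant_fourier n (R : fieldType) (w : R) (A : 'M[R]_n) (a : 'I_n -> R) :
  n.-primitive_root w -> (forall i j, A i j = a (subm i j)) ->
  A *m fourier_mx n w = fourier_mx n w *m diag_mx (\row_k dft w^-1 a k).
Proof.
move=> w_prim AE; apply/matrixP => i k; rewrite mul_mx_diag !mxE /dft mulr_sumr.
rewrite [RHS](reindex_inj (prim_subm_inj (i := i) w_prim)).
apply: eq_bigr => l _.
rewrite !mxE AE mulrCA; congr (_ * _).
rewrite !exprM -exprMn; congr (_ ^+ k).
rewrite exprVn (prim_expr_subm _ _ w_prim) invf_div mulrC divfK //.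
by rewrite expf_neq0 ?(prim_root_neq0 w_prim).
Qed.

Lemma circulant_rank n (R : numFieldType) (w : R) (A : 'M[R]_n) (a : 'I_n -> R) :
  n.-primitive_root w -> (forall i j, A i j = a (subm i j)) ->
  \rank A = #|supp (dft w^-1 a)|.
Proof.
move=> w_prim AE; have F_unit := fourier_mx_unit w_prim.
have F_free : row_free (fourier_mx n w) by rewrite row_free_unit.
rewrite -(mxrankMfree _ F_free).
rewrite (circulant_fourier w_prim AE) eqmxMfull ?row_full_unit // rank_diag_mx.
by apply: eq_card => k; rewrite !inE mxE.
Qed.

Lemma psdmx_congr_diag (C : numClosedFieldType) n (B : 'M[C]_n) (d : 'rV[C]_n) :
  (forall k, 0 <= d 0 k) -> psdmx (B ^t* *m diag_mx d *m B)%sesqui.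
Proof.
move=> d_ge0; split.
  apply/is_hermitianmxP; rewrite expr0 scale1r.
  rewrite !trmx_mul !map_mxM /= tr_diag_mx map_diag_mx trmxCK mulmxA.
  congr (_ *m diag_mx _ *m _).
  by apply/rowP => k; rewrite mxE; apply/esym/CrealP/ger0_real.
move=> x; set y := B *m x.
have -> : (x ^t* *m (B ^t* *m diag_mx d *m B) *m x =
         y ^t* *m diag_mx d *m y)%sesqui.
  by rewrite /y trmx_mul map_mxM !mulmxA.
rewrite mul_mx_diag mxE sumr_ge0 // => k _; rewrite !mxE mulrAC mulr_ge0 //.
by rewrite mulrC mul_conjC_ge0.
Qed.

(** Roots of unity have modulus 1. *)
Lemma conjC_prim_root (C : numClosedFieldType) n (w : C) :
  n.-primitive_root w -> w^* = w^-1.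
Proof.
move=> w_prim; have w_norm : `|w| = 1.
  apply: (@pexpIrn _ n (prim_order_gt0 w_prim)); rewrite ?nnegrE //.
  by rewrite -normrX (prim_expr_order w_prim) normr1 expr1n.
by rewrite invC_norm w_norm expr1n invr1 mul1r.
Qed.

(** This matrix is G^* D G with G the Fourier matrix of 1/w and D the diagonal
matrix of [l]. *)
Lemma psdmx_spectrum (C : numClosedFieldType) n (w : C) (l : 'I_n -> C) :
  n.-primitive_root w -> (forall k, 0 <= l k) ->
  psdmx (\matrix_(i, j) dft w l (subm i j)).
Proof.
move=> w_prim l_ge0.
have -> : \matrix_(i, j) dft w l (subm i j) =
    ((fourier_mx n w^-1) ^t* *m diag_mx (\row_k l k)
      *m fourier_mx n w^-1)%sesqui.
  apply/matrixP => i j; rewrite mul_mx_diag !mxE /dft; apply: eq_bigr => k _.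
  rewrite !mxE rmorphXn /= fmorphV /= (conjC_prim_root w_prim) invrK.
  rewrite [(k * subm i j)%N]mulnC exprM (prim_expr_subm _ _ w_prim).
  by rewrite expr_div_n -!exprM exprVn mulrCA mulrA [(k * i)%N]mulnC
             [(k * j)%N]mulnC.
by apply: psdmx_congr_diag => k; rewrite mxE.
Qed.

Lemma dftK n (R : fieldType) (w : R) (l : 'I_n -> R) k :
  n.-primitive_root w -> dft w^-1 (dft w l) k = n%:R * l k.
Proof.
move=> w_prim.
have dftE z (f : 'I_n -> R) : \row_j dft z f j = \row_j f j *m fourier_mx n z.
  by apply/rowP => j; rewrite !mxE; apply: eq_bigr => i _; rewrite !mxE.
have /rowP/(_ k) : \row_j dft w^-1 (dft w l) j = n%:R *: \row_j l j.
  by rewrite !dftE -mulmxA fourier_mxV // mul_mx_scalar.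
by rewrite !mxE.
Qed.

Lemma dft_conj (C : numClosedFieldType) n (w : C) (l : 'I_n -> C) k :
  n.-primitive_root w -> dft w (fun i => (l i)^*) k = (dft w l (oppm k))^*.
Proof.
move=> w_prim; rewrite /dft rmorph_sum; apply: eq_bigr => j _.
rewrite rmorphM rmorphXn /= (conjC_prim_root w_prim); congr (_ * _).
rewrite exprVn !(mulnC j) !exprM -exprVn; congr (_ ^+ j).
rewrite (prim_expr_mod w_prim); have w_neq0 := prim_root_neq0 w_prim.
apply: (mulIf (expf_neq0 (n - k) w_neq0)); rewrite mulVf ?expf_neq0 // -exprD.
by rewrite subnKC ?(ltnW (ltn_ord k)) // (prim_expr_order w_prim).
Qed.

(** * Spectra with many zeros *)

Lemma null_vector_exists (F : fieldType) n (s : seq 'cV[F]_n) :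
  (size s < n)%N ->
  exists2 v : 'rV_n, v != 0 & forall c, c \in s -> v *m c = 0.
Proof.
move=> lt_s; pose M : 'M_(n, size s) := \matrix_(i, j) (nth 0 s j) i 0.
have kerM : kermx M != 0.
  rewrite -mxrank_eq0 mxrank_ker subn_eq0 -ltnNge.
  exact: leq_ltn_trans (rank_leq_col M) lt_s.
exists (nz_row (kermx M)); first by rewrite nz_row_eq0.
move=> c cs; have /sub_kermxP vM0 := nz_row_sub (kermx M).
have lt_c : (index c s < size s)%N by rewrite index_mem.
have /rowP/(_ (Ordinal lt_c)) := vM0; rewrite !mxE => vc0.
apply/rowP => j; rewrite ord1 [in RHS]mxE -[RHS]vc0 mxE.
by apply: eq_bigr => i _; rewrite !mxE /= nth_index.
Qed.

(** The constraints on [m] are fewer than n complex linear equations, so they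
have a nonzero complex solution v. As [T] is closed under negation, the
conjugate of v is another solution, and the real part or the imaginary part of
v is a nonzero real solution; up to sign it takes a positive value. *)
Lemma real_spectrum_exists (C : numClosedFieldType) n (w : C)
    (T Z : {set 'I_n}) :
  n.-primitive_root w -> (forall j, j \in T -> oppm j \in T) ->
  (#|T| + #|Z| < n)%N ->
  exists m : 'I_n -> C,
    [/\ forall k, m k \is Num.real, exists k, 0 < m k,
        forall k, k \in Z -> m k = 0 & forall j, j \in T -> dft w m j = 0].
Proof.
move=> w_prim T_opp lt_n.
pose good (m : 'I_n -> C) :=
  (forall k, k \in Z -> m k = 0) /\ (forall j, j \in T -> dft w m j = 0).
have goodZ a m : good m -> good (fun k => a * m k).
  move=> [mZ mT]; split=> [k /mZ->|j /mT m0]; first by rewrite mulr0.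
  rewrite /dft; under eq_bigr do rewrite -mulrA.
  by rewrite -mulr_sumr -/(dft w m j) m0 mulr0.
have goodD m1 m2 : good m1 -> good m2 -> good (fun k => m1 k + m2 k).
  move=> [mZ mT] [mZ' mT']; split=> [k kZ|j jT].
    by rewrite mZ // mZ' // addr0.
  rewrite /dft; under eq_bigr do rewrite mulrDl.
  by rewrite big_split /= -/(dft w m1 j) -/(dft w m2 j) mT // mT' // addr0.
have good_conj m : good m -> good (fun k => (m k)^*).
  move=> [mZ mT]; split=> [k /mZ->|j jT]; first by rewrite conjC0.
  by rewrite (dft_conj _ _ w_prim) mT ?conjC0 ?T_opp.
have [v v_good [k0 vk0]] : exists2 v, good v & exists k, v k != 0.
  pose cT (j : 'I_n) : 'cV[C]_n := \col_i w ^+ (i * j).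
  pose cZ (k : 'I_n) : 'cV[C]_n := \col_i (i == k)%:R.
  have [|v v_neq0 vs] := 
    @null_vector_exists C n (map cT (enum T) ++ map cZ (enum Z)).
    by rewrite size_cat !size_map -!cardE.
  exists (v 0); last by apply/rV0Pn.
  split=> [k kZ|j jT].
    have /matrixP/(_ 0 0) : v *m cZ k = 0.
      by apply: vs; rewrite mem_cat map_f ?orbT // mem_enum.
    rewrite !mxE (bigD1 k) //= mxE eqxx mulr1 big1 ?addr0 // => i /negbTE nik.
    by rewrite mxE nik mulr0.
  have /matrixP/(_ 0 0) : v *m cT j = 0.
    by apply: vs; rewrite mem_cat map_f // mem_enum.
  by rewrite !mxE => dft0; rewrite -[RHS]dft0; apply: eq_bigr => i _;
     rewrite mxE.
have [m [m_good m_real [k mk]]] : exists m, [/\ good m,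
   forall k, m k \is Num.real & exists k, m k != 0].
  (* [m] is twice the real part of [v] or, if this part vanishes at [k0],
     minus twice its imaginary part. *)
  have vc_good := good_conj _ v_good.
  have [m1k0|m1k0] := eqVneq (v k0 + (v k0)^* ) 0.
    exists (fun k => 'i * (v k + -1 * (v k)^* )); split.
    - exact: (goodZ 'i _ (goodD _ _ v_good (goodZ (-1) _ vc_good))).
    - move=> k; rewrite CrealE rmorphM rmorphD rmorphM rmorphN rmorph1 /=.
      by rewrite conjCi conjCK; apply/eqP; ring.
    exists k0; rewrite mulf_neq0 ?neq0Ci // mulN1r.
    by rewrite -(addr0_eq m1k0) opprK -mulr2n mulrn_eq0.
  exists (fun k => v k + (v k)^* ); split; [exact: goodD | | by exists k0].
  by move=> k; rewrite CrealE rmorphD /= conjCK addrC.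
have [mk_gt0|mk_le0] := real_ltP (real0 _) (m_real k).
  by exists m; case: m_good; split=> //; exists k.
exists (fun k => -1 * m k); case: (goodZ (-1) _ m_good) => mZ mT; split=> //.
  by move=> i; rewrite mulN1r realN.
by exists k; rewrite mulN1r oppr_gt0 lt_neqAle mk.
Qed.

(** Move from [l] in the direction -[m], where [m] is a real solution that
vanishes on the zeros of [l], until the first coordinate vanishes. Forcing [m]
to vanish also at a point [k0] of the support of [l] keeps the coordinate of
[l] at [k0], so the result is not zero. *)
Lemma spectrum_shrink (C : numClosedFieldType) n (w : C) (T : {set 'I_n})
    (l : 'I_n -> C) :
  n.-primitive_root w -> (forall j, j \in T -> oppm j \in T) ->
  (forall k, 0 <= l k) -> supp l != set0 ->
  (forall j, j \in T -> dft w l j = 0) ->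
  ((#|T| + #|~: supp l|).+1 < n)%N ->
  exists l' : 'I_n -> C,
    [/\ forall k, 0 <= l' k, supp l' != set0,
        forall j, j \in T -> dft w l' j = 0 & (#|supp l'| < #|supp l|)%N].
Proof.
move=> w_prim T_opp l_ge0 /set0Pn[k0 k0l] lT lt_n.
have [|m [m_real [k1 mk1] mZ mT]] :=
  @real_spectrum_exists C n w T (k0 |: ~: supp l) w_prim T_opp.
  by rewrite cardsU1 inE k0l addnCA.
(* The step length [t] is the least ratio [l k / m k] with [m k] positive. *)
have lm_real : {in (fun k => 0 < m k), forall k, l k / m k \is Num.real}.
  by move=> k _; rewrite realM ?realV // ger0_real.
have [k2 mk2 k2_min] := real_arg_minP (i0 := k1) mk1 lm_real.
pose t := l k2 / m k2.
have t_ge0 : 0 <= t by rewrite divr_ge0 // ltW.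
have k2l : k2 \in supp l.
  apply: contraLR mk2 => k2l; rewrite mZ ?ltxx // inE in_setC k2l orbT //.
exists (fun k => l k - t * m k); split.
- move=> k; rewrite subr_ge0.
  have [mk_gt0|mk_le0] := real_ltP (real0 _) (m_real k).
    by rewrite -ler_pdivlMr //; apply: k2_min.
  by apply: le_trans (l_ge0 k); rewrite mulr_ge0_le0.
- apply/set0Pn; exists k0; rewrite inE mZ ?mulr0 ?subr0;
    last by rewrite !inE eqxx.
  by move: k0l; rewrite inE.
- move=> j jT; rewrite /dft.
  under eq_bigr do rewrite mulrBl -mulrA.
  by rewrite sumrB -mulr_sumr -/(dft w l j) -/(dft w m j)
             lT // mT // mulr0 subrr.
apply: proper_card; apply/properP; split.
  apply/subsetP => k; apply: contraLR => kl.
  rewrite inE negbK mZ; last by rewrite inE in_setC kl orbT.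
  by move: kl; rewrite inE negbK mulr0 subr0.
exists k2 => //; rewrite inE negbK /t divfK ?subrr //.
by rewrite gt_eqF.
Qed.

(** Start from the constant spectrum, whose transform is supported at 0, and
shrink the support as long as possible. *)
Lemma vertex_spectrum_exists (C : numClosedFieldType) n (w : C)
    (T : {set 'I_n}) :
  n.-primitive_root w -> (forall j, j \in T -> oppm j \in T) ->
  (forall j : 'I_n, j \in T -> (0 < j)%N) ->
  exists l : 'I_n -> C,
    [/\ forall k, 0 <= l k, supp l != set0,
        forall j, j \in T -> dft w l j = 0 & (n <= (#|T| + #|~: supp l|).+1)%N].
Proof.
move=> w_prim T_opp T_pos; have n_gt0 := prim_order_gt0 w_prim.
pose l0 (k : 'I_n) : C := 1.
have l0_ge0 k : 0 <= l0 k by rewrite ler01.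
have l0_neq0 : supp l0 != set0.
  by apply/set0Pn; exists (Ordinal n_gt0); rewrite inE oner_eq0.
have l0T j : j \in T -> dft w l0 j = 0.
  move=> /T_pos j_gt0; rewrite /dft.
  under eq_bigr do rewrite mul1r mulnC.
  by rewrite (sum_prim_exp _ w_prim) gtn_eqF // mul0r.
have [N] := ubnP #|supp l0|; elim: N l0 l0_ge0 l0_neq0 l0T => //
  N IHN l l_ge0 l_neq0 lT ltlN.
have [le_n|lt_n] := leqP n (#|T| + #|~: supp l|).+1; first by exists l.
have [l' [l'_ge0 l'_neq0 l'T lt_l'l]] :=
  spectrum_shrink w_prim T_opp l_ge0 l_neq0 lT lt_n.
exact: IHN l'_ge0 l'_neq0 l'T (leq_trans lt_l'l ltlN).
Qed.

Lemma prim_rootV (C : numClosedFieldType) n (w : C) :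
  n.-primitive_root w -> n.-primitive_root w^-1.
Proof.
move=> w_prim; rewrite -(conjC_prim_root w_prim).
by rewrite fmorph_primitive_root.
Qed.

(** * The minimum rank *)

Lemma subm0r n (n_gt0 : (0 < n)%N) (i : 'I_n) : subm i (Ordinal n_gt0) = i.
Proof. by apply: val_inj; rewrite /= subn0 modnDr modn_small. Qed.

Lemma circulant_rank_ge (C : numClosedFieldType) p (A : 'M[C]_p)
    (S : {set 'I_p}) :
  prime p -> (forall s : 'I_p, s \in S -> (0 < s)%N) -> S != set0 ->
  circulantmx A -> has_graph A (Circ S) -> (p - #|S| <= \rank A)%N.
Proof.
move=> pr_p S_pos S_neq0 A_circ A_graph.
have [w w_prim] := prim_root_prime_exists C pr_p.
pose o := Ordinal (prime_gt0 pr_p); pose a i := A i o.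
have AE i j : A i j = a (subm i j) by apply: A_circ; rewrite subm0r.
have a_neq0 i : i != o -> (a i != 0) = (i \in S).
  by move=> io; rewrite /a A_graph // /Circ /= io subm0r.
have a_supp : supp a \subset o |: S.
  apply/subsetP => i; rewrite !inE; have [//|io] := eqVneq i o.
  by rewrite a_neq0.
have a_supp0 : supp a != set0.
  have [s sS] := set0Pn _ S_neq0; apply/set0Pn; exists s.
  by rewrite inE a_neq0 // -val_eqE -lt0n S_pos.
have unc := dft_uncertainty pr_p (prim_rootV w_prim) a_supp0.
rewrite (circulant_rank w_prim AE).
have le_a : (#|supp a| <= #|S|.+1)%N.
  apply: leq_trans (subset_leq_card a_supp) _.
  by rewrite cardsU1 -add1n leq_add2r leq_b1.
rewrite leq_subLR -ltnS -addSn; apply: leq_trans unc _.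
by rewrite leq_add2r.
Qed.

Lemma psd_circulant_exists (C : numClosedFieldType) p (S : {set 'I_p}) :
  prime p -> (forall s : 'I_p, s \in S -> (0 < s)%N) ->
  (forall s : 'I_p, s \in S -> oppm s \in S) ->
  exists A : 'M[C]_p,
    [/\ psdmx A, circulantmx A, has_graph A (Circ S) & \rank A = (p - #|S|)%N].
Proof.
move=> pr_p S_pos S_opp; have [w w_prim] := prim_root_prime_exists C pr_p.
pose o := Ordinal (prime_gt0 pr_p).
have oS : o \notin S by apply/negP => /S_pos.
(* Negation is subtraction from 0, and exchanging the arguments of [subm]
   negates it. *)
have oppmK (j : 'I_p) : oppm (oppm j) = j.
  by rewrite -[in LHS](subm0r (prime_gt0 pr_p) j) -!subm_opp subm0r.
pose T := ~: (o |: S).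
have T_pos j : j \in T -> (0 < j)%N.
  by rewrite !inE negb_or -val_eqE lt0n => /andP[].
have T_opp j : j \in T -> oppm j \in T.
  rewrite !inE !negb_or => /andP[jo jS]; apply/andP; split.
    apply: contraNneq jo => oj; rewrite -[j]oppmK oj.
    by rewrite -[X in oppm X](subm0r (prime_gt0 pr_p)) -subm_opp subm0r.
  by apply: contraNN jS => /S_opp; rewrite oppmK.
have [l [l_ge0 l_neq0 lT le_p]] := vertex_spectrum_exists w_prim T_opp T_pos.
have unc := dft_uncertainty pr_p w_prim l_neq0.
have l_supp : supp (dft w l) \subset o |: S.
  by apply/subsetP => j; apply: contraLR => jS; rewrite inE negbK lT // inE.
have cardT := cardsC (o |: S); have cardl := cardsC (supp l).
have := subset_leq_card l_supp.
rewrite cardsU1 oS card_ord -/T in cardT cardl *.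
move=> le_dft.
(* The number of zeros at the vertex and the uncertainty principle leave room
   for equality only, both for the rank and for the support of the first
   column. *)
have arith L D s t z : (p < L + D -> D <= 1 + s -> 1 + s + t = p -> L + z = p ->
    p <= (t + z).+1 -> L = p - s /\ 1 + s <= D)%N by lia.
have [rankE dft_ge] := arith _ _ _ _ _ unc le_dft cardT cardl le_p.
have dft_supp : supp (dft w l) = o |: S.
  by apply/eqP; rewrite eqEcard l_supp cardsU1 oS.
exists (\matrix_(i, j) dft w l (subm i j)); split.
- exact: psdmx_spectrum.
- by move=> i j i' j' e; rewrite !mxE e.
- move=> i j ij; rewrite !mxE /Circ /= ij /=.
  have := in_set (fun j => dft w l j != 0) (subm i j).
  rewrite -/(supp _) dft_supp => <-; rewrite !inE -val_eqE (subm_eq0 _ _ w_prim).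
  by rewrite (negbTE ij).
rewrite (circulant_rank (a := dft w l) w_prim) => [|i j]; last by rewrite mxE.
rewrite -rankE; apply: eq_card => k; rewrite !inE (dftK _ _ w_prim).
by rewrite mulf_eq0 pnatr_eq0 (gtn_eqF (prime_gt0 pr_p)).
Qed.

Theorem theorem5p9 (R : realType) (p : nat) (S : {set 'I_p})
    (p_prime : prime p)
    (S_pos : forall s : 'I_p, s \in S -> (0 < s)%N)
    (S_opp : forall s : 'I_p, s \in S -> oppm s \in S)
    (* For S empty the zero matrix has graph Circ S, and the minimum is 0. *)
    (S_neq0 : S != set0) :
  is_mcr_plus R[i] (Circ S) (p - #|S|)%N.
Proof.
split; first exact: psd_circulant_exists.
by move=> A _; apply: circulant_rank_ge.
Qed.
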